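(* In the setting, and with the primal problems $(\mathrm{P}_{\mathcal C})$, $(\mathrm{P}_{\mathcal D})$ and their Lagrangian dual problems $(\mathrm{D}_{\mathcal C})$, $(\mathrm{D}_{\mathcal D})$ defined in the context, the following hold. (i) (Fine scale.) Suppose that the dual problem $(\mathrm{D}_{\mathcal D})$ has an optimal solution $(\mu_1^*,\mu_2^*,\boldsymbol\omega^* )$ with $\mu_1^*>0$ and $\mu_2^*>0$. Then strong duality holds for $(\mathrm{P}_{\mathcal D})$, i.e. the optimal value of $(\mathrm{P}_{\mathcal D})$ equals the optimal value of $(\mathrm{D}_{\mathcal D})$. (ii) (Coarse scale.) Suppose that the dual problem $(\mathrm{D}_{\mathcal C})$ has an optimal solution $(\mu_0^*,\boldsymbol\omega_{\mathcal C}^* )$ with $\mu_0^*>0$. Then strong duality holds for $(\mathrm{P}_{\mathcal C})$, i.e. the optimal value of $(\mathrm{P}_{\mathcal C})$ equals the optimal value of $(\mathrm{D}_{\mathcal C})$.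
   Context: **Data.** Let $L,P,N,K$ be positive integers with $K<N$. Let $\boldsymbol M\in\mathbb R^{L\times P}$ have rows $\widetilde{\boldsymbol m}_1,\dots,\widetilde{\boldsymbol m}_L$ and a left inverse given by its pseudo-inverse $\boldsymbol M^\dagger\in\mathbb R^{P\times L}$, $\boldsymbol M^\dagger\boldsymbol M=\boldsymbol I_P$. Let $\kappa:\mathcal M\times\mathcal M\to\mathbb R$ be a positive definite (reproducing) kernel on a nonempty compact set $\mathcal M\subset\mathbb R^P$ containing all $\widetilde{\boldsymbol m}_\ell$, and let $\mathcal H$ be its (real) reproducing kernel Hilbert space, with norm $\|\cdot\|_{\mathcal H}$. For $\psi\in\mathcal H$ write $\psi(\boldsymbol M)=[\psi(\widetilde{\boldsymbol m}_1),\dots,\psi(\widetilde{\boldsymbol m}_L)]^\top\in\mathbb R^L$. Let $\boldsymbol y_1,\dots,\boldsymbol y_N\in\mathbb R^L$ be given (pixels). The index set $\{1,\dots,N\}$ is partitioned into nonempty sets $\mathcal N_1,\dots,\mathcal N_K$ (superpixels); $\boldsymbol y_{\mathcal C_i}=\frac1{|\mathcal N_i|}\sum_{n\in\mathcal N_i}\boldsymbol y_n$, and $\boldsymbol y_{\mathcal D_n}=\boldsymbol y_{\mathcal C_i}$ if $n\in\mathcal N_i$. Vectors $\widehat{\boldsymbol a}_{\mathcal D_n}\in\mathbb R^P$ and functions $\widehat\psi_{\mathcal C_n}\in\mathcal H$, $n=1,\dots,N$, are fixed data for the fine scale problem (they are obtained from a solution $(\widehat{\boldsymbol a}_{\mathcal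 C_i},\widehat\psi_{\mathcal C_i})_i$ of the coarse problem by assigning to each $n\in\mathcal N_i$ the values $\widehat{\boldsymbol a}_{\mathcal C_i}$ and $\widehat\psi_{\mathcal C_i}$). $C_0,C_1>0$ are given constants, and $$C_Y=\frac1N\sum_{n=1}^N\|\boldsymbol M^\dagger(\boldsymbol y_n-\boldsymbol y_{\mathcal D_n})\|^2,\qquad C_E=\frac{S-1}{S}\,\|\boldsymbol M^\dagger\boldsymbol\Sigma_{\boldsymbol e}^{1/2}\|_F^2,\quad S=N/K,$$ where $\boldsymbol\Sigma_{\boldsymbol e}\in\mathbb R^{L\times L}$ is a given (positive semidefinite) covariance matrix. $\boldsymbol 1$ denotes the all-ones vector, and vector inequalities are entrywise. **Coarse scale primal $(\mathrm{P}_{\mathcal C})$.** Minimize $\frac12\sum_{i=1}^K\big(\|\psi_{\mathcal C_i}\|_{\mathcal H}^2+\|\boldsymbol a_{\mathcal C_i}\|_2^2\big)$ over $\boldsymbol a_{\mathcal C_i}\in\mathbb R^P$, $\psi_{\mathcal C_i}\in\mathcal H$, $\boldsymbol\xi_{\mathcal C_i}\in\mathbb R^L$ ($i=1,\dots,K$), subject to $\boldsymbol a_{\mathcal C_i}\ge\boldsymbol 0$, $\boldsymbol 1^\top\boldsymbol a_{\mathcal C_i}=1$, $\boldsymbol\xi_{\mathcal C_i}=\boldsymbol y_{\mathcal C_i}-\boldsymbol M\boldsymbol a_{\mathcal C_i}-\psi_{\mathcal C_i}(\boldsymbol M)$ for all $i$, and $\frac1K\sum_{i=1}^K\|\boldsymbol\xi_{\mathcal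 C_i}\|_2^2=C_0$. **Coarse scale dual $(\mathrm{D}_{\mathcal C})$.** The Lagrangian is $$\mathcal J_{\mathcal C}=\sum_{i=1}^K\Big\{\tfrac12\|\psi_{\mathcal C_i}\|_{\mathcal H}^2+\tfrac12\|\boldsymbol a_{\mathcal C_i}\|_2^2+\tfrac{\mu_0}2(\|\boldsymbol\xi_{\mathcal C_i}\|_2^2-C_0)+\lambda_{\mathcal C_i}(\boldsymbol 1^\top\boldsymbol a_{\mathcal C_i}-1)-\boldsymbol\gamma_{\mathcal C_i}^\top\boldsymbol a_{\mathcal C_i}-\boldsymbol\beta_{\mathcal C_i}^\top\big(\boldsymbol\xi_{\mathcal C_i}-\boldsymbol y_{\mathcal C_i}+\boldsymbol M\boldsymbol a_{\mathcal C_i}+\psi_{\mathcal C_i}(\boldsymbol M)\big)\Big\}.$$ $(\mathrm{D}_{\mathcal C})$ is: maximize, over $\mu_0\in\mathbb R$ and $\boldsymbol\omega_{\mathcal C}=(\boldsymbol\beta_{\mathcal C_i},\boldsymbol\gamma_{\mathcal C_i},\lambda_{\mathcal C_i})_{i=1}^K$ with $\boldsymbol\beta_{\mathcal C_i}\in\mathbb R^L$, $\boldsymbol\gamma_{\mathcal C_i}\in\mathbb R^P$, $\boldsymbol\gamma_{\mathcal C_i}\ge\boldsymbol 0$, $\lambda_{\mathcal C_i}\in\mathbb R$, the infimum of $\mathcal J_{\mathcal C}$ over all $\boldsymbol a_{\mathcal C_i}\in\mathbb R^P,\psi_{\mathcal C_i}\in\mathcal H,\boldsymbol\xi_{\mathcal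 C_i}\in\mathbb R^L$. With $\boldsymbol K=[\kappa(\widetilde{\boldsymbol m}_j,\widetilde{\boldsymbol m}_\ell)]_{j,\ell}\in\mathbb R^{L\times L}$, for $\mu_0>0$ this infimum equals $$\sum_{i=1}^K\Big(-\tfrac12\boldsymbol\beta_{\mathcal C_i}^\top\boldsymbol K\boldsymbol\beta_{\mathcal C_i}-\tfrac1{2\mu_0}\|\boldsymbol\beta_{\mathcal C_i}\|^2-\tfrac12\|\boldsymbol M^\top\boldsymbol\beta_{\mathcal C_i}+\boldsymbol\gamma_{\mathcal C_i}-\lambda_{\mathcal C_i}\boldsymbol 1\|^2+\boldsymbol y_{\mathcal C_i}^\top\boldsymbol\beta_{\mathcal C_i}-\lambda_{\mathcal C_i}-\tfrac{\mu_0}2C_0\Big).$$ **Fine scale primal $(\mathrm{P}_{\mathcal D})$.** Minimize $\frac12\sum_{n=1}^N\|\psi_n\|_{\mathcal H}^2$ over $\boldsymbol a_n\in\mathbb R^P$, $\psi_n\in\mathcal H$, $\boldsymbol\xi_n\in\mathbb R^L$, $\boldsymbol\xi_{\psi,n}\in\mathbb R^P$ ($n=1,\dots,N$), subject to, for all $n$, $\boldsymbol a_n\ge\boldsymbol 0$, $\boldsymbol 1^\top\boldsymbol a_n=1$, $\boldsymbol\xi_n=\boldsymbol y_n-\boldsymbol M\boldsymbol a_n-\psi_n(\boldsymbol M)$, $\boldsymbol\xi_{\psi,n}=\boldsymbol M^\dagger(\psi_n(\boldsymbol M)-\widehat\psi_{\mathcal C_n}(\boldsymbol M))$, and $$\frac12\sum_{n=1}^N\|\boldsymbol\xi_n\|_2^2=\frac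 N2C_1,\qquad \frac12\sum_{n=1}^N\big(\|\boldsymbol a_n-\widehat{\boldsymbol a}_{\mathcal D_n}\|_2^2+\|\boldsymbol\xi_{\psi,n}\|^2\big)=\frac N2(C_Y-C_E).$$ **Fine scale dual $(\mathrm{D}_{\mathcal D})$.** The Lagrangian is $$\begin{aligned}\mathcal J_{\mathcal D}=\sum_{n=1}^N\Big\{&\tfrac12\|\psi_n\|_{\mathcal H}^2+\tfrac{\mu_1}2(\|\boldsymbol\xi_n\|_2^2-C_1)+\lambda_n(\boldsymbol 1^\top\boldsymbol a_n-1)+\tfrac{\mu_2}2\big(\|\boldsymbol a_n-\widehat{\boldsymbol a}_{\mathcal D_n}\|_2^2-C_Y+\|\boldsymbol\xi_{\psi,n}\|^2+C_E\big)\\&+\boldsymbol\mu_{3,n}^\top\big(\boldsymbol M^\dagger(\psi_n(\boldsymbol M)-\widehat\psi_{\mathcal C_n}(\boldsymbol M))-\boldsymbol\xi_{\psi,n}\big)-\boldsymbol\beta_n^\top\big(\boldsymbol\xi_n-\boldsymbol y_n+\boldsymbol M\boldsymbol a_n+\psi_n(\boldsymbol M)\big)-\boldsymbol\gamma_n^\top\boldsymbol a_n\Big\}.\end{aligned}$$ $(\mathrm{D}_{\mathcal D})$ is: maximize, over $\mu_1,\mu_2\in\mathbb R$ and $\boldsymbol\omega=(\boldsymbol\beta_n,\boldsymbol\mu_{3,n},\boldsymbol\gamma_n,\lambda_n)_{n=1}^N$ with $\boldsymbol\beta_n\in\mathbb R^L$, $\boldsymbol\mu_{3,n}\in\mathbb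 R^P$, $\boldsymbol\gamma_n\in\mathbb R^P$, $\boldsymbol\gamma_n\ge\boldsymbol 0$, $\lambda_n\in\mathbb R$, the infimum of $\mathcal J_{\mathcal D}$ over all $\boldsymbol a_n\in\mathbb R^P,\psi_n\in\mathcal H,\boldsymbol\xi_n\in\mathbb R^L,\boldsymbol\xi_{\psi,n}\in\mathbb R^P$. For $\mu_1,\mu_2>0$ this infimum equals $$\begin{aligned}\sum_{n=1}^N\Big(&-\tfrac12(\boldsymbol\beta_n-(\boldsymbol M^\dagger)^\top\boldsymbol\mu_{3,n})^\top\boldsymbol K(\boldsymbol\beta_n-(\boldsymbol M^\dagger)^\top\boldsymbol\mu_{3,n})-\tfrac1{2\mu_1}\|\boldsymbol\beta_n\|^2-\tfrac1{2\mu_2}\|\boldsymbol\mu_{3,n}\|^2-\tfrac1{2\mu_2}\|\boldsymbol M^\top\boldsymbol\beta_n+\boldsymbol\gamma_n-\lambda_n\boldsymbol 1\|^2\\&+(\boldsymbol y_n-\boldsymbol M\widehat{\boldsymbol a}_{\mathcal D_n})^\top\boldsymbol\beta_n-(\boldsymbol M^\dagger\widehat\psi_{\mathcal C_n}(\boldsymbol M))^\top\boldsymbol\mu_{3,n}-\widehat{\boldsymbol a}_{\mathcal D_n}^\top\boldsymbol\gamma_n+(\boldsymbol 1^\top\widehat{\boldsymbol a}_{\mathcal D_n}-1)\lambda_n\Big)-\tfrac N2(\mu_1C_1+\mu_2C_Y-\mu_2C_E).\end{aligned}$$ *)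

(* Defs.v *)
From HB Require Import structures.
From mathcomp Require Import all_boot all_order all_algebra.
From mathcomp Require Import all_classical all_reals all_analysis.

Set Implicit Arguments.
Unset Strict Implicit.
Unset Printing Implicit Defensive.

Import Order.TTheory GRing.Theory Num.Theory.
Import numFieldNormedType.Exports.

Local Open Scope classical_set_scope.
Local Open Scope ring_scope.

Section LinearAlgebra.
Context {R : realType}.

(* Squared Frobenius norm, i.e. the squared Euclidean norm on column vectors.
   The library norm on matrices is the max norm. *)
Definition normsq m n (A : 'M[R]_(m, n)) : R := \sum_i \sum_j A i j ^+ 2.

Definition dotv n (u v : 'cV[R]_n) : R := \sum_i u i 0 * v i 0.

Definition nonnegv n (v : 'cV[R]_n) : Prop := forall i, 0 <= v i 0.

Definition ones n : 'cV[R]_n := const_mx 1.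

(* The four Penrose conditions. *)
Definition is_pinv m n (A : 'M[R]_(m, n)) (B : 'M[R]_(n, m)) : Prop :=
  [/\ A *m B *m A = A, B *m A *m B = B,
      (A *m B)^T = A *m B & (B *m A)^T = B *m A].

Definition is_psd n (A : 'M[R]_n) : Prop :=
  A^T = A /\ forall v : 'cV[R]_n, 0 <= dotv v (A *m v).

(* B is the (unique) positive semidefinite square root of A. *)
Definition is_psd_sqrt n (A B : 'M[R]_n) : Prop := is_psd B /\ B *m B = A.

End LinearAlgebra.

Section Kernels.
Context {R : realType} {T : Type}.

Definition pd_kernel (D : set T) (kappa : T -> T -> R) : Prop :=
  (forall x y, D x -> D y -> kappa x y = kappa y x) /\
  (forall (n : nat) (x : 'I_n -> T) (c : 'I_n -> R), (forall i, D (x i)) ->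
     0 <= \sum_i \sum_j c i * c j * kappa (x i) (x j)).

(* A Hilbert space of real functions on D with reproducing kernel kappa. Its
   elements are identified with functions on D through the evaluation map
   rkhs_ev, which is linear and injective; the value of rkhs_ev f outside D is
   irrelevant. Completeness is that of completeNormedModType. *)
Record rkhs (D : set T) (kappa : T -> T -> R) := Rkhs {
  rkhs_space :> completeNormedModType R;
  rkhs_ip : rkhs_space -> rkhs_space -> R;
  rkhs_ev : rkhs_space -> T -> R;
  rkhs_ipC : forall f g, rkhs_ip f g = rkhs_ip g f;
  rkhs_ip_linear : forall a f g h,
    rkhs_ip (a *: f + g) h = a * rkhs_ip f h + rkhs_ip g h;
  rkhs_ip_norm : forall f, rkhs_ip f f = `|f| ^+ 2;
  rkhs_ev_linear : forall a f g x, D x ->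
    rkhs_ev (a *: f + g) x = a * rkhs_ev f x + rkhs_ev g x;
  rkhs_ev_inj : forall f g,
    (forall x, D x -> rkhs_ev f x = rkhs_ev g x) -> f = g;
  rkhs_reproducing : forall x, D x -> exists k : rkhs_space,
    (forall y, D y -> rkhs_ev k y = kappa y x) /\
    (forall f, rkhs_ev f x = rkhs_ip f k) }.

End Kernels.

Definition ev_rows {R : realType} {L P : nat} {D : set 'rV[R]_P}
    {kappa : 'rV[R]_P -> 'rV[R]_P -> R} {H : rkhs D kappa}
    (psi : H) (M : 'M[R]_(L, P)) : 'cV[R]_L :=
  \col_l rkhs_ev psi (row l M).

Section Optimization.
Context {R : realType}.

Definition inf_value (X : Type) (F : set X) (f : X -> R) : \bar R :=
  ereal_inf [set (f x)%:E | x in F].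

Definition dual_function (X W : Type) (J : X -> W -> R) (w : W) : \bar R :=
  ereal_inf [set (J x w)%:E | x in [set: X]].

Definition sup_value (W : Type) (G : set W) (g : W -> \bar R) : \bar R :=
  ereal_sup [set g w | w in G].

Definition maximizer (W : Type) (G : set W) (g : W -> \bar R) (w : W) : Prop :=
  G w /\ forall w', G w' -> (g w' <= g w)%E.

End Optimization.

Section Superpixels.
Context {R : realType} {L N K : nat}.
Variables (Nset : 'I_K -> {set 'I_N}) (y : 'I_N -> 'cV[R]_L).

Definition superpixel_partition : Prop :=
  (forall i, exists n, n \in Nset i) /\ (forall n, exists! i, n \in Nset i).

Definition coarse_pixel (i : 'I_K) : 'cV[R]_L :=
  (#|Nset i|%:R)^-1 *: \sum_(n in Nset i) y n.

(* For a partition this sum has exactly one term, namely coarse_pixel i for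
   the unique i with n \in Nset i. *)
Definition coarse_pixel_of (n : 'I_N) : 'cV[R]_L :=
  \sum_(i < K | n \in Nset i) coarse_pixel i.

Definition const_CY (P : nat) (Md : 'M[R]_(P, L)) : R :=
  (N%:R)^-1 * \sum_(n < N) normsq (Md *m (y n - coarse_pixel_of n)).

End Superpixels.

Definition const_CE {R : realType} {L P : nat} (N K : nat)
    (Md : 'M[R]_(P, L)) (sqrtSigma : 'M[R]_L) : R :=
  let S := N%:R / K%:R in (S - 1) / S * normsq (Md *m sqrtSigma).

Record coarse_primal_var (R : realType) (L P K : nat) (H : Type) :=
  CoarsePrimalVar {
    ca : 'I_K -> 'cV[R]_P;
    cpsi : 'I_K -> H;
    cxi : 'I_K -> 'cV[R]_L }.

Record coarse_dual_var (R : realType) (L P K : nat) := CoarseDualVar {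
  cmu0 : R;
  cbeta : 'I_K -> 'cV[R]_L;
  cgamma : 'I_K -> 'cV[R]_P;
  clambda : 'I_K -> R }.

Section Coarse.
Context {R : realType} {L P K : nat} {D : set 'rV[R]_P}
  {kappa : 'rV[R]_P -> 'rV[R]_P -> R}.
Variables (H : rkhs D kappa) (M : 'M[R]_(L, P)).
Variables (yC : 'I_K -> 'cV[R]_L) (C0 : R).

Local Notation primal := (coarse_primal_var R L P K H).
Local Notation dual := (coarse_dual_var R L P K).

Definition coarse_objective (x : primal) : R :=
  2^-1 * \sum_(i < K) (`|cpsi x i| ^+ 2 + normsq (ca x i)).

Definition coarse_primal_feasible : set primal := [set x |
  (forall i, [/\ nonnegv (ca x i), dotv (ones P) (ca x i) = 1 &
                 cxi x i = yC i - M *m ca x i - ev_rows (cpsi x i) M]) /\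
  (K%:R)^-1 * \sum_(i < K) normsq (cxi x i) = C0].

Definition coarse_lagrangian (x : primal) (w : dual) : R :=
  \sum_(i < K)
   (2^-1 * `|cpsi x i| ^+ 2 + 2^-1 * normsq (ca x i)
    + cmu0 w / 2 * (normsq (cxi x i) - C0)
    + clambda w i * (dotv (ones P) (ca x i) - 1)
    - dotv (cgamma w i) (ca x i)
    - dotv (cbeta w i)
        (cxi x i - yC i + M *m ca x i + ev_rows (cpsi x i) M)).

Definition coarse_dual_feasible : set dual :=
  [set w | forall i, nonnegv (cgamma w i)].

Definition coarse_primal_value : \bar R :=
  inf_value coarse_primal_feasible coarse_objective.

Definition coarse_dual_value : \bar R :=
  sup_value coarse_dual_feasible (dual_function coarse_lagrangian).

Definition coarse_dual_optimal (w : dual) : Prop :=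
  maximizer coarse_dual_feasible (dual_function coarse_lagrangian) w.

End Coarse.

Record fine_primal_var (R : realType) (L P N : nat) (H : Type) :=
  FinePrimalVar {
    fa : 'I_N -> 'cV[R]_P;
    fpsi : 'I_N -> H;
    fxi : 'I_N -> 'cV[R]_L;
    fxipsi : 'I_N -> 'cV[R]_P }.

Record fine_dual_var (R : realType) (L P N : nat) := FineDualVar {
  fmu1 : R;
  fmu2 : R;
  fbeta : 'I_N -> 'cV[R]_L;
  fmu3 : 'I_N -> 'cV[R]_P;
  fgamma : 'I_N -> 'cV[R]_P;
  flambda : 'I_N -> R }.

Section Fine.
Context {R : realType} {L P N : nat} {D : set 'rV[R]_P}
  {kappa : 'rV[R]_P -> 'rV[R]_P -> R}.
Variables (H : rkhs D kappa) (M : 'M[R]_(L, P)) (Md : 'M[R]_(P, L)).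
Variables (y : 'I_N -> 'cV[R]_L) (ahat : 'I_N -> 'cV[R]_P) (psihat : 'I_N -> H).
Variables (C1 CY CE : R).

Local Notation primal := (fine_primal_var R L P N H).
Local Notation dual := (fine_dual_var R L P N).

Definition fine_objective (x : primal) : R :=
  2^-1 * \sum_(n < N) `|fpsi x n| ^+ 2.

Definition fine_primal_feasible : set primal := [set x |
  [/\ forall n, [/\ nonnegv (fa x n), dotv (ones P) (fa x n) = 1,
        fxi x n = y n - M *m fa x n - ev_rows (fpsi x n) M &
        fxipsi x n = Md *m (ev_rows (fpsi x n) M - ev_rows (psihat n) M)],
      2^-1 * \sum_(n < N) normsq (fxi x n) = N%:R / 2 * C1 &
      2^-1 * \sum_(n < N) (normsq (fa x n - ahat n) + normsq (fxipsi x n))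
        = N%:R / 2 * (CY - CE)]].

Definition fine_lagrangian (x : primal) (w : dual) : R :=
  \sum_(n < N)
   (2^-1 * `|fpsi x n| ^+ 2
    + fmu1 w / 2 * (normsq (fxi x n) - C1)
    + flambda w n * (dotv (ones P) (fa x n) - 1)
    + fmu2 w / 2 * (normsq (fa x n - ahat n) - CY + normsq (fxipsi x n) + CE)
    + dotv (fmu3 w n)
        (Md *m (ev_rows (fpsi x n) M - ev_rows (psihat n) M) - fxipsi x n)
    - dotv (fbeta w n)
        (fxi x n - y n + M *m fa x n + ev_rows (fpsi x n) M)
    - dotv (fgamma w n) (fa x n)).

Definition fine_dual_feasible : set dual :=
  [set w | forall n, nonnegv (fgamma w n)].

Definition fine_primal_value : \bar R :=
  inf_value fine_primal_feasible fine_objective.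

Definition fine_dual_value : \bar R :=
  sup_value fine_dual_feasible (dual_function fine_lagrangian).

Definition fine_dual_optimal (w : dual) : Prop :=
  maximizer fine_dual_feasible (dual_function fine_lagrangian) w.

End Fine.

(* Main.v *)
(** Idea: with mu > 0 the Lagrangian J(., w0) at a dual optimum w0 is a strictly
    convex quadratic, so completing squares gives an explicit minimizer x0 and
    J(x, w0) = J(x0, w0) + q(x), where q is a weighted squared distance to x0.
    J is affine in the multipliers, and J(x, w1) - J(x0, w1) is o(1) + O(q(x));
    hence, if J(x0, w1) > J(x0, w0) for some feasible w1, a short step from w0
    towards w1 would increase the dual function. So (x0, w0) is a saddle point.
    Testing the saddle inequality with multipliers proportional to the
    constraint residuals shows that x0 is primal feasible, testing it with zero
    multipliers gives f(x0) <= J(x0, w0), and weak duality concludes. The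
    nonconvexity of the equality-constrained norms plays no role, because mu
    lies in the interior of its domain. *)

Require Import Defs.
From HB Require Import structures.
From mathcomp Require Import all_boot all_order all_algebra.
From mathcomp Require Import all_classical all_reals all_analysis.
From mathcomp Require Import ring lra.

Set Implicit Arguments.
Unset Strict Implicit.
Unset Printing Implicit Defensive.

Import Order.TTheory GRing.Theory Num.Theory.
Import numFieldNormedType.Exports.

Local Open Scope classical_set_scope.
Local Open Scope ring_scope.

(** * Euclidean calculus for column vectors *)

Section Euclidean.
Context {R : realType}.

Lemma normsqE n (u : 'cV[R]_n) : normsq u = \sum_i u i 0 ^+ 2.
Proof. by apply: eq_bigr => i _; rewrite big_ord1. Qed.

Lemma normsq_ge0 n (u : 'cV[R]_n) : 0 <= normsq u.
Proof. by rewrite normsqE sumr_ge0 // => i _; rewrite sqr_ge0. Qed.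

Lemma normsq_le0 n (u : 'cV[R]_n) : normsq u <= 0 -> u = 0.
Proof.
move=> u_le0; have /eqP : normsq u = 0.
  by apply/eqP; rewrite eq_le u_le0 normsq_ge0.
rewrite normsqE psumr_eq0 => [/allP u0|i _]; last exact: sqr_ge0.
apply/colP => i; rewrite mxE; apply/eqP.
by rewrite -sqrf_eq0; apply: u0; rewrite mem_index_enum.
Qed.

Lemma sqr_entry_le_normsq n (u : 'cV[R]_n) i : u i 0 ^+ 2 <= normsq u.
Proof.
rewrite normsqE (bigD1 i) //= lerDl sumr_ge0 // => j _; exact: sqr_ge0.
Qed.

Lemma dotvv n (u : 'cV[R]_n) : dotv u u = normsq u.
Proof. by rewrite normsqE; apply: eq_bigr => i _; rewrite expr2. Qed.

Lemma dotvC n (u v : 'cV[R]_n) : dotv u v = dotv v u.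
Proof. by apply: eq_bigr => i _; rewrite mulrC. Qed.

Lemma dotvDl n (u v w : 'cV[R]_n) : dotv (u + v) w = dotv u w + dotv v w.
Proof.
by rewrite /dotv -big_split; apply: eq_bigr => i _; rewrite mxE mulrDl.
Qed.

Lemma dotvZl n a (u v : 'cV[R]_n) : dotv (a *: u) v = a * dotv u v.
Proof. by rewrite /dotv mulr_sumr; apply: eq_bigr => i _; rewrite mxE mulrA. Qed.

Lemma dotvNl n (u v : 'cV[R]_n) : dotv (- u) v = - dotv u v.
Proof. by rewrite -scaleN1r dotvZl mulN1r. Qed.

Lemma dotvDr n (u v w : 'cV[R]_n) : dotv w (u + v) = dotv w u + dotv w v.
Proof. by rewrite !(dotvC w) dotvDl. Qed.

Lemma dotvZr n a (u v : 'cV[R]_n) : dotv v (a *: u) = a * dotv v u.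
Proof. by rewrite !(dotvC v) dotvZl. Qed.

Lemma dotvNr n (u v : 'cV[R]_n) : dotv v (- u) = - dotv v u.
Proof. by rewrite !(dotvC v) dotvNl. Qed.

Lemma dot0v n (u : 'cV[R]_n) : dotv 0 u = 0.
Proof. by rewrite -(scale0r 0) dotvZl mul0r. Qed.

Lemma dotv0 n (u : 'cV[R]_n) : dotv u 0 = 0.
Proof. by rewrite dotvC dot0v. Qed.

Lemma dotv_mulmx m n (A : 'M[R]_(m, n)) u v :
  dotv u (A *m v) = dotv (A^T *m u) v.
Proof.
have dotE k (s t : 'cV[R]_k) : dotv s t = (s^T *m t) 0 0.
  by rewrite mxE; apply: eq_bigr => i _; rewrite mxE.
by rewrite !dotE trmx_mul trmxK mulmxA.
Qed.

Lemma dotv_ge0 n (u v : 'cV[R]_n) : nonnegv u -> nonnegv v -> 0 <= dotv u v.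
Proof. by move=> u0 v0; apply: sumr_ge0 => i _; rewrite mulr_ge0. Qed.

Lemma nonnegv0 n : nonnegv (0 : 'cV[R]_n).
Proof. by move=> i; rewrite mxE. Qed.

Lemma nonnegv_convex n t (u v : 'cV[R]_n) : 0 <= t <= 1 ->
  nonnegv u -> nonnegv v -> nonnegv ((1 - t) *: u + t *: v).
Proof.
by move=> /andP[t0 t1] u0 v0 i; rewrite !mxE addr_ge0 ?mulr_ge0 ?subr_ge0.
Qed.

Definition negpart n (u : 'cV[R]_n) : 'cV[R]_n := \col_i Num.max 0 (- u i 0).

Lemma negpart_ge0 n (u : 'cV[R]_n) : nonnegv (negpart u).
Proof. by move=> i; rewrite mxE le_max lexx. Qed.

(** Wherever an entry of [negpart u] is nonzero it equals the opposite of that of [u], so each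
    product is minus a square. Hence [negpart u] is an admissible multiplier that detects any
    violation of [nonnegv u]. *)
Lemma dotv_negpart n (u : 'cV[R]_n) : dotv (negpart u) u = - normsq (negpart u).
Proof.
rewrite normsqE -sumrN; apply: eq_bigr => i _; rewrite mxE.
by case: (leP 0 (- u i 0)) => _; ring.
Qed.

Lemma negpart_eq0 n (u : 'cV[R]_n) : negpart u = 0 -> nonnegv u.
Proof.
move=> /colP u0 i; have /eqP := u0 i.
by rewrite !mxE eq_le ge_max lexx oppr_le0 => /andP[].
Qed.

(** [u0] solves the stationarity equation [mu *: (u - b) = g], so the expansion around it has no
    linear term. It serves each Euclidean block of the Lagrangian. *)
Lemma complete_square n mu (b g u : 'cV[R]_n) : mu != 0 ->
  let u0 := b + mu^-1 *: g in
  mu / 2 * normsq (u - b) - dotv g u =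
  mu / 2 * normsq (u0 - b) - dotv g u0 + mu / 2 * normsq (u - u0).
Proof.
move=> mu0 u0; rewrite -!dotvv /u0 !(dotvDl, dotvDr, dotvNl, dotvNr, dotvZl, dotvZr).
rewrite (dotvC g b) (dotvC g u) (dotvC b u); field; exact: mu0.
Qed.

End Euclidean.

(** * Inner product calculus in the reproducing kernel Hilbert space *)

Section RKHS.
Context {R : realType} {T : Type} {D : set T} {kappa : T -> T -> R}.
Variable H : rkhs D kappa.
Implicit Types f g h : H.

Lemma rkhs_ipDl f g h : rkhs_ip (f + g) h = rkhs_ip f h + rkhs_ip g h.
Proof. by have := rkhs_ip_linear 1 f g h; rewrite scale1r mul1r. Qed.

Lemma rkhs_ip0l h : rkhs_ip 0 h = 0.
Proof. by apply: (addIr (rkhs_ip 0 h)); rewrite -rkhs_ipDl !add0r. Qed.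

Lemma rkhs_ipZl a f h : rkhs_ip (a *: f) h = a * rkhs_ip f h.
Proof. by have := rkhs_ip_linear a f 0 h; rewrite !addr0 rkhs_ip0l addr0. Qed.

Lemma rkhs_normD f g : `|f + g| ^+ 2 = `|f| ^+ 2 + 2 * rkhs_ip f g + `|g| ^+ 2.
Proof.
rewrite -!rkhs_ip_norm rkhs_ipDl (rkhs_ipC f (f + g)) (rkhs_ipC g (f + g)).
by rewrite !rkhs_ipDl (rkhs_ipC g f); ring.
Qed.

(* Polarization makes the inner product with a fixed vector a combination of
   squared norms, so no Cauchy-Schwarz inequality is needed below. *)
Lemma rkhs_ipE f g : rkhs_ip f g = 2^-1 * (`|f + g| ^+ 2 - `|f| ^+ 2 - `|g| ^+ 2).
Proof. by rewrite rkhs_normD; field. Qed.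

(** Counterpart of [complete_square] for the function block: the stationary point is the representer
    [g] itself. *)
Lemma rkhs_complete_square f g :
  2^-1 * `|f| ^+ 2 - rkhs_ip f g =
  2^-1 * `|g| ^+ 2 - rkhs_ip g g + 2^-1 * `|f - g| ^+ 2.
Proof.
have -> : `|f| ^+ 2 = `|(f - g) + g| ^+ 2 by rewrite subrK.
have -> : rkhs_ip f g = rkhs_ip (f - g) g + rkhs_ip g g by rewrite -rkhs_ipDl subrK.
by rewrite rkhs_normD -!rkhs_ip_norm; field.
Qed.

End RKHS.

(** By the reproducing property, evaluation at each row of [M] is the inner product with a kernel
    section; the representer is the combination of these sections with coefficients [v]. *)
Lemma dotv_ev_rows (R : realType) (L P : nat) (D : set 'rV[R]_P)
    (kappa : 'rV[R]_P -> 'rV[R]_P -> R) (H : rkhs D kappa) (M : 'M[R]_(L, P)) :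
  (forall l, D (row l M)) -> forall v : 'cV[R]_L,
  exists r : H, forall psi : H, dotv v (ev_rows psi M) = rkhs_ip psi r.
Proof.
move=> hMD v.
have /choice[k kE] : forall l, exists k : H,
    forall f : H, rkhs_ev f (row l M) = rkhs_ip f k.
  by move=> l; have [k [_ kE]] := rkhs_reproducing H (hMD l); exists k.
exists (\sum_l v l 0 *: k l) => psi; rewrite rkhs_ipC /dotv.
rewrite (@big_morph _ _ (fun f => rkhs_ip f psi) 0 +%R); last 2 first.
- by move=> f g; exact: rkhs_ipDl.
- exact: rkhs_ip0l.
by apply: eq_bigr => l _; rewrite mxE kE rkhs_ipZl rkhs_ipC.
Qed.

(** * Growth of functions measured against a gap [q] *)

Section Growth.
Context {R : realType} {X : Type}.
Variables (q : X -> R) (x0 : X).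
Hypothesis q_ge0 : forall x, 0 <= q x.
Implicit Types f g : X -> R.

(** Lipschitz at [x0] with respect to the square root of [q], squared to avoid roots. *)
Definition lip_at f := exists2 B, 0 <= B & forall x, (f x - f x0) ^+ 2 <= B * q x.

(** The o(1) + O(q) condition, uniform over all of [X]: an arbitrarily small constant error is
    bought with a large multiple of [q]. *)
Definition tame_at f := forall e, 0 < e ->
  exists2 B, 0 <= B & forall x, `|f x - f x0| <= e + B * q x.

Lemma lip_at_tame f : lip_at f -> tame_at f.
Proof.
move=> [B B0 fB] e e0; exists (B / (4 * e)); first by rewrite divr_ge0 // mulr_ge0 // ltW.
move=> x; set d := f x - f x0.
(* Arithmetic-geometric mean inequality: after multiplication by [4 * e] it says that
   [(|d| - 2 * e) ^+ 2] is nonnegative. *)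
have : `|d| <= e + d ^+ 2 / (4 * e).
  rewrite -(ler_pM2l (_ : 0 < 4 * e)) ?mulr_gt0 // -[d ^+ 2]real_normK ?num_real //.
  have -> : 4 * e * (e + `|d| ^+ 2 / (4 * e)) = 4 * e ^+ 2 + `|d| ^+ 2.
    by field; rewrite gt_eqF.
  by have := sqr_ge0 (`|d| - 2 * e); rewrite !expr2; lra.
move/le_trans; apply; rewrite lerD2l [leRHS]mulrAC.
by apply: ler_wpM2r; [rewrite invr_ge0 mulr_ge0 // ltW | exact: fB].
Qed.

Lemma lip_atB f c : lip_at f -> lip_at (fun x => f x - c).
Proof.
by move=> [B B0 fB]; exists B => // x; rewrite opprB addrA subrK.
Qed.

Lemma tame_at_cst c : tame_at (fun=> c).
Proof. by move=> e e0; exists 0 => // x; rewrite subrr normr0 mul0r addr0 ltW. Qed.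

Lemma tame_atD f g : tame_at f -> tame_at g -> tame_at (fun x => f x + g x).
Proof.
move=> hf hg e e0; have e20 : 0 < e / 2 by rewrite divr_gt0.
have [A A0 fA] := hf _ e20; have [B B0 gB] := hg _ e20.
exists (A + B); first by rewrite addr_ge0.
move=> x; have -> : f x + g x - (f x0 + g x0) = (f x - f x0) + (g x - g x0) by ring.
by apply: le_trans (ler_normD _ _) _; have := fA x; have := gB x; lra.
Qed.

Lemma tame_atZ c f : tame_at f -> tame_at (fun x => c * f x).
Proof.
(* Adding 1 keeps the divisor positive when [c = 0]. *)
move=> hf e e0; have c0 : 0 < `|c| + 1 by rewrite ltr_pwDr.
have [B B0 fB] := hf (e / (`|c| + 1)) (divr_gt0 e0 c0).
exists ((`|c| + 1) * B); first by rewrite mulr_ge0 // ltW.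
move=> x; rewrite -mulrBr normrM.
apply: (@le_trans _ _ ((`|c| + 1) * `|f x - f x0|)); first by rewrite ler_wpM2r // lerDl.
apply: (@le_trans _ _ ((`|c| + 1) * (e / (`|c| + 1) + B * q x))).
  by rewrite ler_pM2l.
by rewrite mulrDr mulrCA divff ?gt_eqF // mulr1 mulrA.
Qed.

Lemma tame_atN f : tame_at f -> tame_at (fun x => - f x).
Proof.
move=> hf e /hf[B B0 fB]; exists B => // x.
by rewrite -opprD normrN.
Qed.

Lemma tame_atB f g : tame_at f -> tame_at g -> tame_at (fun x => f x - g x).
Proof. by move=> hf hg; apply: tame_atD => //; exact: tame_atN. Qed.

Lemma tame_at_sum n (f : 'I_n -> X -> R) :
  (forall i, tame_at (f i)) -> tame_at (fun x => \sum_i f i x).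
Proof.
move=> hf; elim: n f hf => [|n IHn] f hf.
  by under eq_fun do rewrite big_ord0; exact: tame_at_cst.
under eq_fun do rewrite big_ord_recl.
by apply: tame_atD => //; apply: IHn.
Qed.

(** Around [f x0] the square splits into a linear increment, which is tame, and a squared increment,
    which is O(q). *)
Lemma lip_at_sqr f : lip_at f -> tame_at (fun x => f x ^+ 2).
Proof.
move=> hf e e0.
have [A A0 fA] := tame_atZ (2 * f x0) (lip_at_tame hf) e0.
have [B B0 fB] := hf; exists (A + B); first by rewrite addr_ge0.
move=> x; have -> : f x ^+ 2 - f x0 ^+ 2 =
  (2 * f x0 * f x - 2 * f x0 * f x0) + (f x - f x0) ^+ 2 by ring.
apply: le_trans (ler_normD _ _) _; rewrite (ger0_norm (sqr_ge0 _)).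
by have := fA x; have := fB x; lra.
Qed.

Lemma tame_at_normsq n (u : X -> 'cV[R]_n) b :
  (forall i, lip_at (fun x => u x i 0)) -> tame_at (fun x => normsq (u x - b)).
Proof.
move=> hu; under eq_fun do rewrite normsqE.
apply: tame_at_sum => i; apply: lip_at_sqr.
by under eq_fun do rewrite !mxE; exact: lip_atB.
Qed.

Lemma tame_at_dotv n (u : X -> 'cV[R]_n) v :
  (forall i, lip_at (fun x => u x i 0)) -> tame_at (fun x => dotv v (u x)).
Proof.
by move=> hu; apply: tame_at_sum => i; apply: tame_atZ; exact: lip_at_tame.
Qed.

Lemma lip_at_entry n (u : X -> 'cV[R]_n) (c : R) : 0 < c ->
  (forall x, c * normsq (u x - u x0) <= q x) ->
  forall i, lip_at (fun x => u x i 0).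
Proof.
move=> c0 hu i; exists c^-1; first by rewrite invr_ge0 ltW.
move=> x; apply: le_trans (_ : normsq (u x - u x0) <= _).
  by have := sqr_entry_le_normsq (u x - u x0) i; rewrite !mxE.
by rewrite ler_pdivlMl.
Qed.

(** Reverse triangle inequality. The shift [v] covers both norms that occur in polarization: [v = g]
    and [v = 0]. *)
Lemma lip_at_norm (V : normedModType R) (f : X -> V) (c : R) (v : V) : 0 < c ->
  (forall x, c * `|f x - f x0| ^+ 2 <= q x) -> lip_at (fun x => `|f x + v|).
Proof.
move=> c0 hf; exists c^-1; first by rewrite invr_ge0 ltW.
move=> x; apply: le_trans (_ : `|f x - f x0| ^+ 2 <= _); last first.
  by rewrite ler_pdivlMl.
rewrite -[leLHS]real_normK ?num_real // lerXn2r ?nnegrE //.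
apply: le_trans (ler_dist_dist _ _) _.
by rewrite opprD addrACA subrr addr0.
Qed.

Lemma tame_at_rkhs_ip (T : Type) (D : set T) (kappa : T -> T -> R)
    (H : rkhs D kappa) (f : X -> H) (c : R) (g : H) : 0 < c ->
  (forall x, c * `|f x - f x0| ^+ 2 <= q x) -> tame_at (fun x => rkhs_ip (f x) g).
Proof.
(* The added zero gives the unshifted norm the shape of [lip_at_norm]. *)
move=> c0 hf; under eq_fun do rewrite rkhs_ipE -{2}[f _]addr0.
apply: tame_atZ; apply: tame_atB; last exact: tame_at_cst.
by apply: tame_atB; apply: lip_at_sqr; apply: lip_at_norm hf.
Qed.

End Growth.

(** * From a dual maximizer to a saddle point, and from there to strong duality *)

Section Saddle.
Context {R : realType} {X W : Type}.
Variables (G : set W) (J : X -> W -> R).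

(** Along the path, [J x w] is at least [J x0 w0 + t * (d / 2) + (1 - t - t * B) * q x], where [d]
    is the supposed excess of [J x0 w1]. Tameness makes this uniform in [x], so it bounds the
    infimum, that is, the dual function. *)
Lemma saddle_point (q : X -> R) (x0 : X) (w0 w1 : W) :
  (forall x, 0 <= q x) -> (forall x, J x w0 = J x0 w0 + q x) ->
  maximizer G (dual_function J) w0 -> tame_at q x0 (J^~ w1) ->
  (forall t, 0 <= t <= 1 ->
     exists2 w, G w & forall x, J x w = (1 - t) * J x w0 + t * J x w1) ->
  J x0 w1 <= J x0 w0.
Proof.
move=> q0 Jq [_ w0max] J1 path; rewrite leNgt; apply/negP => lt01.
(* The step t = 1 / (1 + B) makes the coefficient 1 - t - t B of q x vanish. *)
set d := J x0 w1 - J x0 w0; have d0 : 0 < d by rewrite subr_gt0.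
(* The tolerance [d / 2] leaves half of the gain [d]. *)
have [B B0 JB] := J1 _ (divr_gt0 d0 (ltr0Sn _ 1)).
have B10 : 0 < 1 + B by rewrite ltr_pwDl.
pose t := (1 + B)^-1; have t0 : 0 < t by rewrite invr_gt0.
have tB : t * (1 + B) = 1 by rewrite mulVf // gt_eqF.
have [|w Gw Jw] := path t; first by rewrite ltW // invf_le1 // lerDl.
have : ((J x0 w0 + t * (d / 2))%:E <= (J x0 w0)%:E)%E.
  apply: (@le_trans _ _ (dual_function J w)).
    apply: le_ereal_inf_tmp => _ [x _ <-]; rewrite lee_fin Jw (Jq x).
    have := JB x; rewrite ler_norml => /andP[+ _].
    rewrite -(ler_pM2l t0) => hB.
    suff : t * (B * q x) = q x - t * q x by rewrite /d in hB *; lra.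
    have tB' : t * B = 1 - t by lra.
    by rewrite mulrA tB'; ring.
  apply: le_trans (w0max _ Gw) _.
  by apply: ereal_inf_lbound; exists x0.
by rewrite lee_fin gerDl leNgt mulr_gt0 // divr_gt0.
Qed.

(** The last hypothesis says that [f x0] is at most the dual function at [w0], so the primal infimum
    lies below the dual supremum; weak duality gives the converse. *)
Lemma strong_duality (F : set X) (f : X -> R) (x0 : X) (w0 : W) :
  (forall x w, F x -> G w -> J x w <= f x) ->
  F x0 -> G w0 -> (forall x, f x0 <= J x w0) ->
  inf_value F f = sup_value G (dual_function J).
Proof.
move=> weak Fx0 Gw0 fJ; apply/eqP; rewrite eq_le; apply/andP; split.
  apply: (@le_trans _ _ (f x0)%:E); first by apply: ereal_inf_lbound; exists x0.
  apply: (@le_trans _ _ (dual_function J w0)).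
    by apply: le_ereal_inf_tmp => _ [x _ <-]; rewrite lee_fin.
  by apply: ereal_sup_ubound; exists w0.
apply: ge_ereal_sup => _ [w Gw <-]; apply: le_ereal_inf_tmp => _ [x Fx <-].
apply: (@le_trans _ _ (J x w)%:E); first by apply: ereal_inf_lbound; exists x.
by rewrite lee_fin weak.
Qed.

End Saddle.

(** * Tests by scaled multipliers: what boundedness along rays and lines implies *)

Lemma bounded_ray_le0 (R : realType) (a b m : R) :
  (forall s, 0 <= s -> a + s * b <= m) -> b <= 0.
Proof.
move=> h; rewrite leNgt; apply/negP => b0.
(* At this parameter the affine function equals [a + |m - a| + 1], which exceeds [m]. *)
have /h : 0 <= (`|m - a| + 1) / b by rewrite divr_ge0 // ?addr_ge0 // ltW.
rewrite divfK ?gt_eqF // => ham.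
have := ler_norm (m - a); lra.
Qed.

Section Tests.
Context {R : realType} {N : nat}.

Lemma bounded_line_eq0 (a b m : R) : (forall s, a + s * b <= m) -> b = 0.
Proof.
move=> h; apply/eqP; rewrite eq_le -oppr_le0.
rewrite (@bounded_ray_le0 _ a b m) ?(@bounded_ray_le0 _ a (- b) m) //.
by move=> s _; rewrite mulrN -mulNr.
Qed.

Lemma sum_dot0v n (v : 'I_N -> 'cV[R]_n) : \sum_i dotv 0 (v i) = 0.
Proof. by apply: big1 => i _; exact: dot0v. Qed.

Lemma sum_mul0r (v : 'I_N -> R) : \sum_i 0 * v i = 0.
Proof. by apply: big1 => i _; exact: mul0r. Qed.

Lemma sum_dotvZl n s (u v : 'I_N -> 'cV[R]_n) :
  \sum_i dotv (s *: u i) (v i) = s * \sum_i dotv (u i) (v i).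
Proof. by rewrite mulr_sumr; apply: eq_bigr => i _; exact: dotvZl. Qed.

Lemma sum_dotvv n (u : 'I_N -> 'cV[R]_n) :
  \sum_i dotv (u i) (u i) = \sum_i normsq (u i).
Proof. by apply: eq_bigr => i _; exact: dotvv. Qed.

Lemma sum_dotv_negpart n (u : 'I_N -> 'cV[R]_n) :
  \sum_i dotv (negpart (u i)) (u i) = - \sum_i normsq (negpart (u i)).
Proof. by rewrite -sumrN; apply: eq_bigr => i _; exact: dotv_negpart. Qed.

Lemma sum_mul_sqr s (u : 'I_N -> R) : \sum_i s * u i * u i = s * \sum_i u i ^+ 2.
Proof. by rewrite mulr_sumr; apply: eq_bigr => i _; rewrite expr2 mulrA. Qed.

Lemma sum_normsq_le0 n (u : 'I_N -> 'cV[R]_n) :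
  \sum_i normsq (u i) <= 0 -> forall i, u i = 0.
Proof.
move=> u0 i; apply: normsq_le0; apply: le_trans u0.
by rewrite (bigD1 i) //= lerDl sumr_ge0 // => j _; exact: normsq_ge0.
Qed.

Lemma sum_sqr_le0 (u : 'I_N -> R) : \sum_i u i ^+ 2 <= 0 -> forall i, u i = 0.
Proof.
move=> u0 i; apply/eqP; rewrite -sqrf_eq0 eq_le sqr_ge0 andbT; apply: le_trans u0.
by rewrite (bigD1 i) //= lerDl sumr_ge0 // => j _; exact: sqr_ge0.
Qed.

End Tests.

(** Collapses the Lagrangian at a test multiplier, where at most one family is nonzero. *)
Local Notation zero_sumE :=
  (sum_dot0v, sum_mul0r, sum_dotvZl, mul0r, mulr0, addr0, subr0).

(** * The fine scale problem *)

Section Fine.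
Context {R : realType} {L P N : nat} {D : set 'rV[R]_P}
  {kappa : 'rV[R]_P -> 'rV[R]_P -> R}.
Variables (H : rkhs D kappa) (M : 'M[R]_(L, P)) (Md : 'M[R]_(P, L)).
Variables (y : 'I_N -> 'cV[R]_L) (ahat : 'I_N -> 'cV[R]_P) (psihat : 'I_N -> H).
Variables (C1 CY CE : R).
Hypothesis hMD : forall l, D (row l M).

Local Notation primal := (fine_primal_var R L P N H).
Local Notation dual := (fine_dual_var R L P N).
Local Notation J := (fine_lagrangian M Md y ahat psihat C1 CY CE).
Local Notation F := (fine_primal_feasible M Md y ahat psihat C1 CY CE).
Local Notation G := (@fine_dual_feasible R L P N).

Definition fine_fit (x : primal) n : 'cV[R]_L :=
  fxi x n - y n + M *m fa x n + ev_rows (fpsi x n) M.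

Definition fine_drift (x : primal) n : 'cV[R]_P :=
  Md *m (ev_rows (fpsi x n) M - ev_rows (psihat n) M) - fxipsi x n.

(** Regrouped by multiplier instead of by pixel, so that a test multiplier isolates one
    constraint. *)
Lemma fine_lagrangianE x w : J x w =
  fine_objective x
  + fmu1 w / 2 * \sum_n (normsq (fxi x n) - C1)
  + fmu2 w / 2 * \sum_n (normsq (fa x n - ahat n) + normsq (fxipsi x n) - (CY - CE))
  + \sum_n flambda w n * (dotv (ones P) (fa x n) - 1)
  + \sum_n dotv (fmu3 w n) (fine_drift x n)
  - \sum_n dotv (fbeta w n) (fine_fit x n)
  - \sum_n dotv (fgamma w n) (fa x n).
Proof.
rewrite /fine_objective !mulr_sumr -!sumrN -!big_split /=.
by apply: eq_bigr => n _; rewrite /fine_fit /fine_drift; ring.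
Qed.

Definition fine_segment t (w0 w1 : dual) : dual :=
  FineDualVar ((1 - t) * fmu1 w0 + t * fmu1 w1) ((1 - t) * fmu2 w0 + t * fmu2 w1)
    (fun n => (1 - t) *: fbeta w0 n + t *: fbeta w1 n)
    (fun n => (1 - t) *: fmu3 w0 n + t *: fmu3 w1 n)
    (fun n => (1 - t) *: fgamma w0 n + t *: fgamma w1 n)
    (fun n => (1 - t) * flambda w0 n + t * flambda w1 n).

Lemma fine_lagrangian_affine x t w0 w1 :
  J x (fine_segment t w0 w1) = (1 - t) * J x w0 + t * J x w1.
Proof.
rewrite /fine_lagrangian !mulr_sumr -big_split; apply: eq_bigr => n _ /=.
by rewrite !(dotvDl, dotvZl); ring.
Qed.

(** The purely quadratic part of the Lagrangian at [w], recentred at [x0]; it is the [q] of the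
    abstract saddle argument. *)
Definition fine_gap (x0 : primal) (w : dual) (x : primal) : R := \sum_n
  (2^-1 * `|fpsi x n - fpsi x0 n| ^+ 2
   + fmu1 w / 2 * normsq (fxi x n - fxi x0 n)
   + fmu2 w / 2 * normsq (fa x n - fa x0 n)
   + fmu2 w / 2 * normsq (fxipsi x n - fxipsi x0 n)).

(** For fixed [w] the Lagrangian separates over the pixels, and for each pixel over the four primal
    blocks; a square is completed in each block. *)
Lemma fine_minimizer w : 0 < fmu1 w -> 0 < fmu2 w ->
  exists x0, forall x, J x w = J x0 w + fine_gap x0 w x.
Proof.
move=> mu1 mu2.
(* Both [fbeta] and [fmu3] act on [psi] through its samples; the transpose of [Md] merges them into
   one functional. *)
have /choice[r rE] : forall n, exists r : H, forall psi : H,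
    dotv (fbeta w n - Md^T *m fmu3 w n) (ev_rows psi M) = rkhs_ip psi r.
  by move=> n; exact: dotv_ev_rows.
(* Minus the coefficient of [fa] in the linear terms of the Lagrangian. *)
pose g n := M^T *m fbeta w n + fgamma w n - flambda w n *: ones P.
(* The summands [0 +] match [complete_square] with [b = 0]. *)
pose x0 := @FinePrimalVar R L P N H (fun n => ahat n + (fmu2 w)^-1 *: g n) r
  (fun n => 0 + (fmu1 w)^-1 *: fbeta w n) (fun n => 0 + (fmu2 w)^-1 *: fmu3 w n).
exists x0 => x; rewrite /fine_lagrangian /fine_gap -big_split /=.
apply: eq_bigr => n _.
have JE (z : primal) :
  2^-1 * `|fpsi z n| ^+ 2 + fmu1 w / 2 * (normsq (fxi z n) - C1)
  + flambda w n * (dotv (ones P) (fa z n) - 1)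
  + fmu2 w / 2 * (normsq (fa z n - ahat n) - CY + normsq (fxipsi z n) + CE)
  + dotv (fmu3 w n)
      (Md *m (ev_rows (fpsi z n) M - ev_rows (psihat n) M) - fxipsi z n)
  - dotv (fbeta w n)
      (fxi z n - y n + M *m fa z n + ev_rows (fpsi z n) M)
  - dotv (fgamma w n) (fa z n) =
  (2^-1 * `|fpsi z n| ^+ 2 - rkhs_ip (fpsi z n) (r n))
  + (fmu1 w / 2 * normsq (fxi z n - 0) - dotv (fbeta w n) (fxi z n))
  + (fmu2 w / 2 * normsq (fa z n - ahat n) - dotv (g n) (fa z n))
  + (fmu2 w / 2 * normsq (fxipsi z n - 0) - dotv (fmu3 w n) (fxipsi z n))
  + (dotv (fbeta w n) (y n) - dotv (fmu3 w n) (Md *m ev_rows (psihat n) M)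
     - flambda w n - fmu1 w / 2 * C1 - fmu2 w / 2 * (CY - CE)).
  rewrite -rE /g !subr0 mulmxBr.
  rewrite !(dotvDl, dotvDr, dotvNl, dotvNr, dotvZl) !(dotv_mulmx _ (fmu3 w n)).
  by rewrite -(dotv_mulmx M); ring.
rewrite (JE x) (JE x0).
rewrite (rkhs_complete_square (fpsi x n) (r n)).
rewrite (complete_square 0 (fbeta w n) (fxi x n) (lt0r_neq0 mu1)).
rewrite (complete_square (ahat n) (g n) (fa x n) (lt0r_neq0 mu2)).
rewrite (complete_square 0 (fmu3 w n) (fxipsi x n) (lt0r_neq0 mu2)).
by rewrite /=; ring.
Qed.

Lemma fine_gap_ge0 x0 w x : 0 < fmu1 w -> 0 < fmu2 w -> 0 <= fine_gap x0 w x.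
Proof.
move=> /ltW mu1 /ltW mu2; apply: sumr_ge0 => n _.
by rewrite !addr_ge0 ?mulr_ge0 ?normsq_ge0 ?sqr_ge0.
Qed.

Lemma fine_gap_ge x0 w x n : 0 < fmu1 w -> 0 < fmu2 w ->
  [/\ 2^-1 * `|fpsi x n - fpsi x0 n| ^+ 2 <= fine_gap x0 w x,
      fmu1 w / 2 * normsq (fxi x n - fxi x0 n) <= fine_gap x0 w x,
      fmu2 w / 2 * normsq (fa x n - fa x0 n) <= fine_gap x0 w x &
      fmu2 w / 2 * normsq (fxipsi x n - fxipsi x0 n) <= fine_gap x0 w x].
Proof.
move=> /ltW mu1 /ltW mu2; rewrite /fine_gap (bigD1 n) //=.
set S := \sum_(i < N | _) _.
have S0 : 0 <= S.
  by apply: sumr_ge0 => i _; rewrite !addr_ge0 ?mulr_ge0 ?normsq_ge0 ?sqr_ge0.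
have h1 : 0 <= 2^-1 * `|fpsi x n - fpsi x0 n| ^+ 2 by rewrite mulr_ge0 ?sqr_ge0.
have h2 : 0 <= fmu1 w / 2 * normsq (fxi x n - fxi x0 n).
  by rewrite !mulr_ge0 ?normsq_ge0.
have h3 : 0 <= fmu2 w / 2 * normsq (fa x n - fa x0 n).
  by rewrite !mulr_ge0 ?normsq_ge0.
have h4 : 0 <= fmu2 w / 2 * normsq (fxipsi x n - fxipsi x0 n).
  by rewrite !mulr_ge0 ?normsq_ge0.
by split; lra.
Qed.

(** The gap controls the squared displacement of every block, and [J^~ w1] combines squared norms
    and linear functionals of the blocks. Tameness is two-sided, so the multipliers of [w1] may have
    any sign. *)
Lemma fine_lagrangian_tame x0 w w1 : 0 < fmu1 w -> 0 < fmu2 w ->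
  tame_at (fine_gap x0 w) x0 (J^~ w1).
Proof.
move=> mu1 mu2.
have q0 x : 0 <= fine_gap x0 w x by exact: fine_gap_ge0.
have mu12 : 0 < fmu1 w / 2 by rewrite divr_gt0.
have mu22 : 0 < fmu2 w / 2 by rewrite divr_gt0.
have two : 0 < 2^-1 :> R by rewrite invr_gt0.
have lxi n i : lip_at (fine_gap x0 w) x0 (fun x => fxi x n i 0).
  by apply: (lip_at_entry mu12) => x; case: (fine_gap_ge x0 x n mu1 mu2).
have la n i : lip_at (fine_gap x0 w) x0 (fun x => fa x n i 0).
  by apply: (lip_at_entry mu22) => x; case: (fine_gap_ge x0 x n mu1 mu2).
have lxipsi n i : lip_at (fine_gap x0 w) x0 (fun x => fxipsi x n i 0).
  by apply: (lip_at_entry mu22) => x; case: (fine_gap_ge x0 x n mu1 mu2).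
have qpsi n x : 2^-1 * `|fpsi x n - fpsi x0 n| ^+ 2 <= fine_gap x0 w x.
  by case: (fine_gap_ge x0 x n mu1 mu2).
have tnorm n : tame_at (fine_gap x0 w) x0 (fun x => `|fpsi x n| ^+ 2).
  apply: lip_at_sqr => //; under eq_fun do rewrite -[fpsi _ _]addr0.
  exact: lip_at_norm (qpsi n).
have tev n v : tame_at (fine_gap x0 w) x0 (fun x => dotv v (ev_rows (fpsi x n) M)).
  have [r rE] := dotv_ev_rows H hMD v; under eq_fun do rewrite rE.
  exact: tame_at_rkhs_ip (qpsi n).
have tcst c : tame_at (fine_gap x0 w) x0 (fun=> c) by exact: tame_at_cst.
have tnormsq k (u : primal -> 'cV[R]_k) :
    (forall i, lip_at (fine_gap x0 w) x0 (fun x => u x i 0)) ->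
    tame_at (fine_gap x0 w) x0 (fun x => normsq (u x)).
  by move=> lu; under eq_fun do rewrite -[u _]subr0; exact: tame_at_normsq.
apply: tame_at_sum => n.
(* The matrices move to the multiplier side, so that each linear term pairs a fixed vector with a
   single block. *)
under eq_fun do rewrite mulmxBr !(dotvDr, dotvNr)
  !(dotv_mulmx _ _ (ev_rows (fpsi _ _) _)) (dotv_mulmx M).
repeat first [apply: tame_atN | apply: tame_atZ | exact: tnorm | exact: tev
  | exact: tcst | by apply: tame_at_normsq | by apply: tnormsq
  | by apply: tame_at_dotv | apply: tame_atD => //].
Qed.

(** A nonzero residual, used as its own multiplier and scaled up, would make [J x0] unbounded
    above. *)
Lemma fine_saddle_feasible x0 m : (forall w, G w -> J x0 w <= m) ->
  F x0 /\ fine_objective x0 <= m.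
Proof.
move=> Jm.
pose o k := fun _ : 'I_N => 0 : 'cV[R]_k.
have Jw mu1 mu2 b u g l : (forall n, nonnegv (g n)) ->
    J x0 (FineDualVar mu1 mu2 b u g l) <= m by move=> g0; exact: Jm.
have o0 : forall n, nonnegv (o P n) by move=> n; exact: nonnegv0.
(* The sign of the test multiplier is reversed because [fbeta] enters the Lagrangian with a minus
   sign. *)
have fitE : forall n, fine_fit x0 n = 0.
  apply: sum_normsq_le0; apply: (@bounded_ray_le0 _ (fine_objective x0) _ m) => s _.
  have := Jw 0 0 (fun n => - s *: fine_fit x0 n) (o P) (o P) (fun=> 0) o0.
  by rewrite fine_lagrangianE /= !zero_sumE sum_dotvv mulNr opprK.
have driftE : forall n, fine_drift x0 n = 0.
  apply: sum_normsq_le0; apply: (@bounded_ray_le0 _ (fine_objective x0) _ m) => s _.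
  have := Jw 0 0 (o L) (fun n => s *: fine_drift x0 n) (o P) (fun=> 0) o0.
  by rewrite fine_lagrangianE /= !zero_sumE sum_dotvv.
have sumE : forall n, dotv (ones P) (fa x0 n) - 1 = 0.
  apply: (@sum_sqr_le0 _ _ (fun n => dotv (ones P) (fa x0 n) - 1)).
  apply: (@bounded_ray_le0 _ (fine_objective x0) _ m) => s _.
  have := Jw 0 0 (o L) (o P) (o P) (fun n => s * (dotv (ones P) (fa x0 n) - 1)) o0.
  by rewrite fine_lagrangianE /= !zero_sumE sum_mul_sqr.
(* Only [s >= 0] keeps the test [fgamma] feasible, hence a ray and not a line. *)
have a0 n : nonnegv (fa x0 n).
  apply: negpart_eq0; move: n; apply: sum_normsq_le0.
  apply: (@bounded_ray_le0 _ (fine_objective x0) _ m) => s s0.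
  have := Jw 0 0 (o L) (o P) (fun n => s *: negpart (fa x0 n)) (fun=> 0).
  rewrite fine_lagrangianE /= !zero_sumE sum_dotv_negpart mulrN opprK; apply => n i.
  by rewrite mxE mulr_ge0 // negpart_ge0.
(* The residual of a summed constraint has no definite sign, but its scalar multiplier is free, so a
   whole line is tested. The factor 2 cancels the half in [fmu1 w / 2]. *)
have xiE : \sum_n (normsq (fxi x0 n) - C1) = 0.
  apply: (@bounded_line_eq0 _ (fine_objective x0) _ m) => s.
  have := Jw (2 * s) 0 (o L) (o P) (o P) (fun=> 0) o0.
  by rewrite fine_lagrangianE /= !zero_sumE (mulrC 2) mulfK.
have aE : \sum_n (normsq (fa x0 n - ahat n) + normsq (fxipsi x0 n) - (CY - CE)) = 0.
  apply: (@bounded_line_eq0 _ (fine_objective x0) _ m) => s.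
  have := Jw 0 (2 * s) (o L) (o P) (o P) (fun=> 0) o0.
  by rewrite fine_lagrangianE /= !zero_sumE (mulrC 2) mulfK.
split; last first.
  have := Jw 0 0 (o L) (o P) (o P) (fun=> 0) o0.
  by rewrite fine_lagrangianE /= !zero_sumE.
split.
- move=> n; split => //.
  + by apply/eqP; rewrite -subr_eq0 sumE.
  + move: (fitE n); rewrite /fine_fit => /eqP; rewrite -!addrA addr_eq0 => /eqP->.
    by rewrite !opprD opprK addrA.
  + by apply/esym/eqP; rewrite -subr_eq0; apply/eqP; exact: driftE.
- move: xiE; rewrite sumrB sumr_const card_ord -mulr_natl => /eqP.
  by rewrite subr_eq0 => /eqP ->; ring.
- move: aE; rewrite sumrB sumr_const card_ord -mulr_natl => /eqP.
  by rewrite subr_eq0 => /eqP ->; ring.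
Qed.

(** On feasible points every equality term vanishes, and what remains beyond the objective is minus
    a sum of products of nonnegative vectors. *)
Lemma fine_weak_duality x w : F x -> G w -> J x w <= fine_objective x.
Proof.
move=> [cons xiE aE] Gw; rewrite fine_lagrangianE.
have -> : \sum_n (normsq (fxi x n) - C1) = 0.
  by rewrite sumrB sumr_const card_ord -mulr_natl; lra.
have -> : \sum_n (normsq (fa x n - ahat n) + normsq (fxipsi x n) - (CY - CE)) = 0.
  by rewrite sumrB sumr_const card_ord -mulr_natl; lra.
(* Cleared in turn: the sums carrying [flambda], [fmu3] and [fbeta]. *)
rewrite [X in _ + X + _ - _ - _]big1; last first.
  by move=> n _; have [_ -> _ _] := cons n; rewrite subrr mulr0.
rewrite [X in _ + X - _ - _]big1; last first.
  by move=> n _; rewrite /fine_drift; have [_ _ _ ->] := cons n; rewrite subrr dotv0.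
rewrite [X in _ + _ - X - _]big1; last first.
  move=> n _; rewrite /fine_fit; have [_ _ -> _] := cons n.
  have cancel (u v t : 'cV[R]_L) : u - v - t - u + v + t = 0.
    by apply/colP => i; rewrite !mxE; ring.
  by rewrite cancel dotv0.
rewrite !mulr0 !addr0 subr0 gerBl sumr_ge0 // => n _.
by apply: dotv_ge0; [exact: Gw | case: (cons n)].
Qed.

Lemma fine_strong_duality w0 :
  fine_dual_optimal M Md y ahat psihat C1 CY CE w0 -> 0 < fmu1 w0 -> 0 < fmu2 w0 ->
  fine_primal_value M Md y ahat psihat C1 CY CE =
  fine_dual_value M Md y ahat psihat C1 CY CE.
Proof.
move=> opt mu1 mu2; have [x0 Jgap] := fine_minimizer mu1 mu2.
have gap0 x := fine_gap_ge0 x0 x mu1 mu2.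
(* The saddle inequality supplies the bound [m = J x0 w0] over all feasible multipliers. *)
have [|Fx0 fx0] := @fine_saddle_feasible x0 (J x0 w0).
  move=> w1 Gw1; apply: (saddle_point gap0 Jgap opt).
    exact: fine_lagrangian_tame.
  move=> t t01; exists (fine_segment t w0 w1).
    by move=> n; apply: nonnegv_convex => //; exact: opt.1.
  by move=> x; exact: fine_lagrangian_affine.
apply: (strong_duality fine_weak_duality Fx0 opt.1) => x.
by rewrite Jgap (le_trans fx0) // lerDl.
Qed.

End Fine.

(** * The coarse scale problem, by the same route *)

Section Coarse.
Context {R : realType} {L P K : nat} {D : set 'rV[R]_P}
  {kappa : 'rV[R]_P -> 'rV[R]_P -> R}.
Variables (H : rkhs D kappa) (M : 'M[R]_(L, P)).
Variables (yC : 'I_K -> 'cV[R]_L) (C0 : R).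
Hypothesis hMD : forall l, D (row l M).

Local Notation primal := (coarse_primal_var R L P K H).
Local Notation dual := (coarse_dual_var R L P K).
Local Notation J := (@coarse_lagrangian R L P K D kappa H M yC C0).
Local Notation F := (@coarse_primal_feasible R L P K D kappa H M yC C0).
Local Notation G := (@coarse_dual_feasible R L P K).

Definition coarse_fit (x : primal) i : 'cV[R]_L :=
  cxi x i - yC i + M *m ca x i + ev_rows (cpsi x i) M.

Lemma coarse_lagrangianE x w : J x w =
  coarse_objective x
  + cmu0 w / 2 * \sum_i (normsq (cxi x i) - C0)
  + \sum_i clambda w i * (dotv (ones P) (ca x i) - 1)
  - \sum_i dotv (cbeta w i) (coarse_fit x i)
  - \sum_i dotv (cgamma w i) (ca x i).
Proof.
rewrite /coarse_objective !mulr_sumr -!sumrN -!big_split /=.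
by apply: eq_bigr => i _; rewrite /coarse_fit; ring.
Qed.

Definition coarse_segment t (w0 w1 : dual) : dual :=
  CoarseDualVar ((1 - t) * cmu0 w0 + t * cmu0 w1)
    (fun i => (1 - t) *: cbeta w0 i + t *: cbeta w1 i)
    (fun i => (1 - t) *: cgamma w0 i + t *: cgamma w1 i)
    (fun i => (1 - t) * clambda w0 i + t * clambda w1 i).

Lemma coarse_lagrangian_affine x t w0 w1 :
  J x (coarse_segment t w0 w1) = (1 - t) * J x w0 + t * J x w1.
Proof.
rewrite /coarse_lagrangian !mulr_sumr -big_split; apply: eq_bigr => i _ /=.
by rewrite !(dotvDl, dotvZl); ring.
Qed.

(** The block [ca] takes its curvature from the objective, so its weight is a constant and not a
    multiplier. *)
Definition coarse_gap (x0 : primal) (w : dual) (x : primal) : R := \sum_i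
  (2^-1 * `|cpsi x i - cpsi x0 i| ^+ 2
   + cmu0 w / 2 * normsq (cxi x i - cxi x0 i)
   + 1 / 2 * normsq (ca x i - ca x0 i)).

Lemma coarse_minimizer w : 0 < cmu0 w ->
  exists x0, forall x, J x w = J x0 w + coarse_gap x0 w x.
Proof.
move=> mu0.
have /choice[r rE] : forall i, exists r : H, forall psi : H,
    dotv (cbeta w i) (ev_rows psi M) = rkhs_ip psi r.
  by move=> i; exact: dotv_ev_rows.
pose g i := M^T *m cbeta w i + cgamma w i - clambda w i *: ones P.
(* The term |a|^2 / 2 is put in the form of [complete_square] with mu = 1, b = 0. *)
pose x0 := @CoarsePrimalVar R L P K H (fun i => 0 + 1^-1 *: g i) r
  (fun i => 0 + (cmu0 w)^-1 *: cbeta w i).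
exists x0 => x; rewrite /coarse_lagrangian /coarse_gap -big_split /=.
apply: eq_bigr => i _.
have JE (z : primal) :
  2^-1 * `|cpsi z i| ^+ 2 + 2^-1 * normsq (ca z i)
  + cmu0 w / 2 * (normsq (cxi z i) - C0)
  + clambda w i * (dotv (ones P) (ca z i) - 1)
  - dotv (cgamma w i) (ca z i)
  - dotv (cbeta w i)
      (cxi z i - yC i + M *m ca z i + ev_rows (cpsi z i) M) =
  (2^-1 * `|cpsi z i| ^+ 2 - rkhs_ip (cpsi z i) (r i))
  + (cmu0 w / 2 * normsq (cxi z i - 0) - dotv (cbeta w i) (cxi z i))
  + (1 / 2 * normsq (ca z i - 0) - dotv (g i) (ca z i))
  + (dotv (cbeta w i) (yC i) - clambda w i - cmu0 w / 2 * C0).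
  rewrite -rE /g !subr0.
  rewrite !(dotvDl, dotvDr, dotvNl, dotvNr, dotvZl).
  by rewrite -(dotv_mulmx M); ring.
rewrite (JE x) (JE x0).
rewrite (rkhs_complete_square (cpsi x i) (r i)).
rewrite (complete_square 0 (cbeta w i) (cxi x i) (lt0r_neq0 mu0)).
rewrite (complete_square 0 (g i) (ca x i) (oner_neq0 _)).
by rewrite /=; ring.
Qed.

Lemma coarse_gap_ge0 x0 w x : 0 < cmu0 w -> 0 <= coarse_gap x0 w x.
Proof.
move=> /ltW mu0; apply: sumr_ge0 => i _.
by rewrite !addr_ge0 ?mulr_ge0 ?normsq_ge0 ?sqr_ge0.
Qed.

Lemma coarse_gap_ge x0 w x i : 0 < cmu0 w ->
  [/\ 2^-1 * `|cpsi x i - cpsi x0 i| ^+ 2 <= coarse_gap x0 w x,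
      cmu0 w / 2 * normsq (cxi x i - cxi x0 i) <= coarse_gap x0 w x &
      1 / 2 * normsq (ca x i - ca x0 i) <= coarse_gap x0 w x].
Proof.
move=> /ltW mu0; rewrite /coarse_gap (bigD1 i) //=.
set S := \sum_(j < K | _) _.
have S0 : 0 <= S.
  by apply: sumr_ge0 => j _; rewrite !addr_ge0 ?mulr_ge0 ?normsq_ge0 ?sqr_ge0.
have h1 : 0 <= 2^-1 * `|cpsi x i - cpsi x0 i| ^+ 2 by rewrite mulr_ge0 ?sqr_ge0.
have h2 : 0 <= cmu0 w / 2 * normsq (cxi x i - cxi x0 i).
  by rewrite !mulr_ge0 ?normsq_ge0.
have h3 := normsq_ge0 (ca x i - ca x0 i).
by split; lra.
Qed.

Lemma coarse_lagrangian_tame x0 w w1 : 0 < cmu0 w ->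
  tame_at (coarse_gap x0 w) x0 (J^~ w1).
Proof.
move=> mu0.
have q0 x : 0 <= coarse_gap x0 w x by exact: coarse_gap_ge0.
have mu02 : 0 < cmu0 w / 2 by rewrite divr_gt0.
have half : 0 < 1 / 2 :> R by rewrite divr_gt0.
have two : 0 < 2^-1 :> R by rewrite invr_gt0.
have lxi i j : lip_at (coarse_gap x0 w) x0 (fun x => cxi x i j 0).
  by apply: (lip_at_entry mu02) => x; case: (coarse_gap_ge x0 x i mu0).
have la i j : lip_at (coarse_gap x0 w) x0 (fun x => ca x i j 0).
  by apply: (lip_at_entry half) => x; case: (coarse_gap_ge x0 x i mu0).
have qpsi i x : 2^-1 * `|cpsi x i - cpsi x0 i| ^+ 2 <= coarse_gap x0 w x.
  by case: (coarse_gap_ge x0 x i mu0).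
have tnorm i : tame_at (coarse_gap x0 w) x0 (fun x => `|cpsi x i| ^+ 2).
  apply: lip_at_sqr => //; under eq_fun do rewrite -[cpsi _ _]addr0.
  exact: lip_at_norm (qpsi i).
have tev i v : tame_at (coarse_gap x0 w) x0 (fun x => dotv v (ev_rows (cpsi x i) M)).
  have [r rE] := dotv_ev_rows H hMD v; under eq_fun do rewrite rE.
  exact: tame_at_rkhs_ip (qpsi i).
have tcst c : tame_at (coarse_gap x0 w) x0 (fun=> c) by exact: tame_at_cst.
have tnormsq k (u : primal -> 'cV[R]_k) :
    (forall i, lip_at (coarse_gap x0 w) x0 (fun x => u x i 0)) ->
    tame_at (coarse_gap x0 w) x0 (fun x => normsq (u x)).
  by move=> lu; under eq_fun do rewrite -[u _]subr0; exact: tame_at_normsq.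
apply: tame_at_sum => i.
under eq_fun do rewrite !(dotvDr, dotvNr) (dotv_mulmx M).
repeat first [apply: tame_atN | apply: tame_atZ | exact: tnorm | exact: tev
  | exact: tcst | by apply: tnormsq | by apply: tame_at_dotv
  | apply: tame_atD => //].
Qed.

Lemma coarse_saddle_feasible x0 m : (0 < K)%N -> (forall w, G w -> J x0 w <= m) ->
  F x0 /\ coarse_objective x0 <= m.
Proof.
move=> K0 Jm.
pose o k := fun _ : 'I_K => 0 : 'cV[R]_k.
have Jw mu0 b g l : (forall i, nonnegv (g i)) ->
    J x0 (CoarseDualVar mu0 b g l) <= m by move=> g0; exact: Jm.
have o0 : forall i, nonnegv (o P i) by move=> i; exact: nonnegv0.
have fitE : forall i, coarse_fit x0 i = 0.
  apply: sum_normsq_le0; apply: (@bounded_ray_le0 _ (coarse_objective x0) _ m) => s _.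
  have := Jw 0 (fun i => - s *: coarse_fit x0 i) (o P) (fun=> 0) o0.
  by rewrite coarse_lagrangianE /= !zero_sumE sum_dotvv mulNr opprK.
have sumE : forall i, dotv (ones P) (ca x0 i) - 1 = 0.
  apply: (@sum_sqr_le0 _ _ (fun i => dotv (ones P) (ca x0 i) - 1)).
  apply: (@bounded_ray_le0 _ (coarse_objective x0) _ m) => s _.
  have := Jw 0 (o L) (o P) (fun i => s * (dotv (ones P) (ca x0 i) - 1)) o0.
  by rewrite coarse_lagrangianE /= !zero_sumE sum_mul_sqr.
have a0 i : nonnegv (ca x0 i).
  apply: negpart_eq0; move: i; apply: sum_normsq_le0.
  apply: (@bounded_ray_le0 _ (coarse_objective x0) _ m) => s s0.
  have := Jw 0 (o L) (fun i => s *: negpart (ca x0 i)) (fun=> 0).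
  rewrite coarse_lagrangianE /= !zero_sumE sum_dotv_negpart mulrN opprK; apply => i j.
  by rewrite mxE mulr_ge0 // negpart_ge0.
have xiE : \sum_i (normsq (cxi x0 i) - C0) = 0.
  apply: (@bounded_line_eq0 _ (coarse_objective x0) _ m) => s.
  have := Jw (2 * s) (o L) (o P) (fun=> 0) o0.
  by rewrite coarse_lagrangianE /= !zero_sumE (mulrC 2) mulfK.
split; last first.
  have := Jw 0 (o L) (o P) (fun=> 0) o0.
  by rewrite coarse_lagrangianE /= !zero_sumE.
split.
- move=> i; split => //.
  + by apply/eqP; rewrite -subr_eq0 sumE.
  + move: (fitE i); rewrite /coarse_fit => /eqP; rewrite -!addrA addr_eq0 => /eqP->.
    by rewrite !opprD opprK addrA.
- move: xiE; rewrite sumrB sumr_const card_ord -[C0 *+ K]mulr_natl => /eqP.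
  (* The constraint is stated as a mean, so returning from the sum divides by [K]; this is where
     [K0] enters. *)
  by rewrite subr_eq0 => /eqP ->; rewrite mulKf // pnatr_eq0 -lt0n.
Qed.

Lemma coarse_weak_duality x w : (0 < K)%N -> F x -> G w -> J x w <= coarse_objective x.
Proof.
move=> K0 [cons xiE] Gw; rewrite coarse_lagrangianE.
have -> : \sum_i (normsq (cxi x i) - C0) = 0.
  rewrite sumrB sumr_const card_ord -mulr_natl -xiE mulVKf ?subrr //.
  by rewrite pnatr_eq0 -lt0n.
rewrite [X in _ + X - _ - _]big1; last first.
  by move=> i _; have [_ -> _] := cons i; rewrite subrr mulr0.
rewrite [X in _ + _ - X - _]big1; last first.
  move=> i _; rewrite /coarse_fit; have [_ _ ->] := cons i.
  have cancel (u v t : 'cV[R]_L) : u - v - t - u + v + t = 0.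
    by apply/colP => j; rewrite !mxE; ring.
  by rewrite cancel dotv0.
rewrite !mulr0 !addr0 subr0 gerBl sumr_ge0 // => i _.
by apply: dotv_ge0; [exact: Gw | case: (cons i)].
Qed.

Lemma coarse_strong_duality w0 : (0 < K)%N ->
  coarse_dual_optimal H M yC C0 w0 -> 0 < cmu0 w0 ->
  coarse_primal_value H M yC C0 = coarse_dual_value H M yC C0.
Proof.
move=> K0 opt mu0; have [x0 Jgap] := coarse_minimizer mu0.
have gap0 x := coarse_gap_ge0 x0 x mu0.
have [|Fx0 fx0] := @coarse_saddle_feasible x0 (J x0 w0) K0.
  move=> w1 Gw1; apply: (saddle_point gap0 Jgap opt).
    exact: coarse_lagrangian_tame.
  move=> t t01; exists (coarse_segment t w0 w1).
    by move=> i; apply: nonnegv_convex => //; exact: opt.1.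
  by move=> x; exact: coarse_lagrangian_affine.
have weak x w := @coarse_weak_duality x w K0.
apply: (strong_duality weak Fx0 opt.1) => x.
by rewrite Jgap (le_trans fx0) // lerDl.
Qed.

End Coarse.

Theorem theorem1 (R : realType) (L P N K : nat)
    (hL : (0 < L)%N) (hP : (0 < P)%N) (hK : (0 < K)%N) (hKN : (K < N)%N)
    (M : 'M[R]_(L, P)) (Md : 'M[R]_(P, L))
    (hMd : is_pinv M Md) (hMdM : Md *m M = 1%:M)
    (D : set 'rV[R]_P) (hDcompact : compact D) (hD0 : D !=set0)
    (hMD : forall l : 'I_L, D (row l M))
    (kappa : 'rV[R]_P -> 'rV[R]_P -> R) (hkappa : pd_kernel D kappa)
    (H : rkhs D kappa)
    (y : 'I_N -> 'cV[R]_L)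
    (Nset : 'I_K -> {set 'I_N}) (hNset : superpixel_partition Nset)
    (ahat : 'I_N -> 'cV[R]_P) (psihat : 'I_N -> H)
    (C0 C1 : R) (hC0 : 0 < C0) (hC1 : 0 < C1)
    (Sigma sqrtSigma : 'M[R]_L)
    (hSigma : is_psd Sigma) (hsqrt : is_psd_sqrt Sigma sqrtSigma) :
  let CY := const_CY Nset y Md in
  let CE := const_CE N K Md sqrtSigma in
  let yC := coarse_pixel Nset y in
  ((exists w : fine_dual_var R L P N,
      [/\ fine_dual_optimal M Md y ahat psihat C1 CY CE w,
          0 < fmu1 w & 0 < fmu2 w]) ->
   fine_primal_value M Md y ahat psihat C1 CY CE =
   fine_dual_value M Md y ahat psihat C1 CY CE) /\
  ((exists w : coarse_dual_var R L P K,
      coarse_dual_optimal H M yC C0 w /\ 0 < cmu0 w) ->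
   coarse_primal_value H M yC C0 = coarse_dual_value H M yC C0).
Proof.
move=> CY CE yC; split => [[w [opt mu1 mu2]]|[w [opt mu0]]].
- exact: fine_strong_duality opt mu1 mu2.
- exact: coarse_strong_duality opt mu0.
Qed.
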